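(* Assume the convex setting described in the context. Suppose that on every compact set $X\subseteq\operatorname{dom}F$ the following hold: (C1) for every $x\in X$ the moment generating function $M_x(t)=\mathbb{E}[e^{t(f_\xi(x)-F(x))}]$ is finite for all $t$ in a neighborhood of $0$; (C2) there is a measurable $\kappa:\Xi\to\mathbb{R}_+$ with $\mathbb{E}[\kappa(\xi)]=L<\infty$ such that $f_\xi$ is $\kappa(\xi)$-Lipschitz on $X$ for all $\xi$; (C3) $\mathbb{E}[e^{t\kappa(\xi)}]$ is finite for all $t$ in a neighborhood of $0$. If the set $\mathcal{X}^*$ of optimal solutions of $\inf_{x\in\mathcal X}F(x)$ is contained in the interior of $\operatorname{dom}F$, then there exist positive constants $C$ and $\beta$, independent of $N$, such that \[\mathbb{P}^N\{d(x^*(\xi^{[N]}))<1\}\le Ce^{-N\beta}.\]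
   Context: Setting: $\mathcal{X}\subseteq\mathbb{R}^n$ is a nonempty closed convex set; $\xi$ is a random vector with support $\Xi$ and distribution $\mathbb P$; for each $\xi\in\Xi$, $f_\xi:\mathbb{R}^n\to\mathbb{R}\cup\{+\infty\}$ is convex; $F(x)=\mathbb{E}[f_\xi(x)]$, with $F>-\infty$ everywhere and $F(x)<+\infty$ for some $x\in\mathcal X$; $\operatorname{dom}F=\{x:F(x)<+\infty\}$; the optimal set $\mathcal X^*$ of $\inf_{x\in\mathcal X}F(x)$ is nonempty and compact. $\xi^{[N]}=(\xi^1,\dots,\xi^N)$ is an i.i.d. sample with product measure $\mathbb P^N$, $\hat F_N(x)=\frac1N\sum_{i=1}^Nf_{\xi^i}(x)$, and $x^*(\xi^{[N]})$ is an optimal solution of the SAA problem $\inf_{x\in\mathcal X}\hat F_N(x)$ (assigned to each sample, with $\hat F_N(x^* )<+\infty$). Degree of feasibility: $d(x^*(\xi^{[N]}))=\mathbb{P}\{\xi\in\Xi:f_\xi(x^*(\xi^{[N]}))<+\infty\}$. *)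

(* Defs.v *)
From HB Require Import structures.
From mathcomp Require Import all_boot all_order all_algebra.
From mathcomp Require Import all_classical all_reals all_analysis measurable_realfun.
Set Implicit Arguments. Unset Strict Implicit. Unset Printing Implicit Defensive.
Import Order.TTheory GRing.Theory Num.Theory.
Import numFieldNormedType.Exports.
Local Open Scope classical_set_scope.
Local Open Scope ring_scope.

Section defs.
Context {R : realType} {n : nat} {d : measure_display} {T : measurableType d}.
Local Open Scope ereal_scope.

Definition econvex (g : 'rV[R]_n -> \bar R) : Prop :=
  forall (x y : 'rV[R]_n) (t : R), (0 < t < 1)%R ->
    g (t *: x + (1 - t) *: y)%R <= t%:E * g x + (1 - t)%:E * g y.

Definition Fexp (P : probability T R) (f : T -> 'rV[R]_n -> \bar R)
  (x : 'rV[R]_n) : \bar R := \int[P]_xi f xi x.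

Definition domF (P : probability T R) (f : T -> 'rV[R]_n -> \bar R) :
  set 'rV[R]_n := [set x | Fexp P f x < +oo].

Definition feas_degree (P : probability T R) (f : T -> 'rV[R]_n -> \bar R)
  (x : 'rV[R]_n) : \bar R := P [set xi | f xi x < +oo].

Definition optimal_set (X : set 'rV[R]_n) (G : 'rV[R]_n -> \bar R) :
  set 'rV[R]_n := [set x | X x /\ G x = ereal_inf (G @` X)].

Definition SAA_obj (f : T -> 'rV[R]_n -> \bar R) (N : nat) (s : 'I_N -> T)
  (x : 'rV[R]_n) : \bar R := ((N%:R)^-1)%:E * \sum_(i < N) f (s i) x.

Definition is_SAA_solution (X : set 'rV[R]_n) (f : T -> 'rV[R]_n -> \bar R)
  (N : nat) (s : 'I_N -> T) (x : 'rV[R]_n) : Prop :=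
  X x /\ SAA_obj f s x < +oo /\ (forall y, X y -> SAA_obj f s x <= SAA_obj f s y).

(* g is L-Lipschitz on K (real-valued there) *)
Definition elipschitz_on (K : set 'rV[R]_n) (g : 'rV[R]_n -> \bar R) (L : R) : Prop :=
  forall x y, K x -> K y -> `|g x - g y| <= (L * `|(x - y)%R|)%:E.

End defs.

Definition iid_seq {R : realType} {d d' : measure_display}
  {T : measurableType d} {Omega : measurableType d'}
  (Q : probability Omega R) (P : probability T R) (xi : nat -> Omega -> T) : Prop :=
  [/\ (forall i, measurable_fun setT (xi i)),
      (forall i (A : set T), measurable A -> Q (xi i @^-1` A) = P A) &
      (forall (m : nat) (A : nat -> set T), (forall i, measurable (A i)) ->
         Q (\bigcap_(i in `I_m) (xi i @^-1` A i)) = (\prod_(i < m) P (A i))%E)].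

(* Main.v *)
(* Fix a minimizer x0 and an open bounded U around the optimal set whose closure
   K lies in dom F; by (C2) every f_xi is finite on K, so only the event that the
   SAA solution leaves U matters. On that event the segment from x0 to the SAA
   solution crosses the compact boundary S of U inside the feasible set, and by
   convexity the SAA objective at the crossing point z is at most its value at
   x0. But F > F(x0) on S: around each y in S there is a radius e for which
   f(x0) - f(y) + e kappa has negative mean, and if |z - y| < e the empirical sum
   of this function is nonnegative. Covering S by finitely many such balls, the
   event is contained in a finite union of large deviations of i.i.d. sums with
   finite moment generating function near 0, each exponentially unlikely by
   Chernoff's bound. *)
Require Import Defs.
From HB Require Import structures.
From mathcomp Require Import all_boot all_order all_algebra.
From mathcomp Require Import all_classical all_reals all_analysis measurable_realfun.
From mathcomp Require Import ring lra.
Set Implicit Arguments. Unset Strict Implicit. Unset Printing Implicit Defensive.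
Import Order.TTheory GRing.Theory Num.Theory.
Import numFieldNormedType.Exports HBNNSimple.
Local Open Scope classical_set_scope.
Local Open Scope ring_scope.

(** * Expectation of a product of i.i.d. factors *)

(** Factorization passes from indicators to nonnegative functions of [Y] by linearity on simple
    functions and monotone convergence. Below, [W] is the product of the remaining factors. *)
Lemma integral_mul_comp_factor (R : realType) (d d' : measure_display)
    (T : measurableType d) (Omega : measurableType d')
    (P : measure T R) (Q : measure Omega R)
    (W : Omega -> R) (Y : Omega -> T) (c : R) (h : T -> R) :
  measurable_fun setT W -> (forall w, 0 <= W w) -> measurable_fun setT Y ->
  0 <= c ->
  (forall A, measurable A ->
    (\int[Q]_w (W w * \1_A (Y w))%:E = c%:E * P A)%E) ->
  measurable_fun setT h -> (forall t, 0 <= h t) ->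
  (\int[Q]_w (W w * h (Y w))%:E = c%:E * \int[P]_t (h t)%:E)%E.
Proof.
move=> mW W0 mY c0 WA mh h0.
have mEh : measurable_fun setT (EFin \o h) by exact/measurable_EFinP.
have Eh0 t : [set: T] t -> (0 <= (EFin \o h) t)%E by rewrite lee_fin.
pose g := nnsfun_approx measurableT mEh.
have g0 k t : 0 <= g k t by exact: fun_ge0.
have mg k : measurable_fun setT (g k) by exact: measurable_funPT.
have mgY k : measurable_fun setT (g k \o Y) by exact: measurableT_comp.
have gh t : EFin \o g ^~ t @ \oo --> (h t)%:E.
  exact: (cvg_nnsfun_approx measurableT mEh Eh0).
have ndg t : {homo (fun k => g k t) : k l / (k <= l)%N >-> k <= l}.
  by move=> k l kl; have /lefP := nd_nnsfun_approx measurableT mEh kl; exact.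
have mpre k r : measurable (g k @^-1` [set r]) by exact: measurable_funPTI.
have simple k :
    (\int[Q]_w (W w * g k (Y w))%:E = c%:E * \int[P]_t (g k t)%:E)%E.
  have fr : finite_set (range (g k)) by exact: fimfunP.
  rewrite integralT_nnsfun sintegralE.
  rewrite ge0_mule_fsumr//; last by move=> r; exact: nnsfun_mulemu_ge0.
  have pos r w : (0 <= r * (W w * \1_(g k @^-1` [set r]) (Y w)))%R.
    rewrite mulrCA mulr_ge0//; have := nnfun_muleindic_ge0 (g k) r (Y w).
    by rewrite -EFinM lee_fin.
  have mWI r : measurable_fun setT
      (fun w => (W w * \1_(g k @^-1` [set r]) (Y w))%R).
    apply: measurable_funM => //.
    by apply: (measurableT_comp _ mY); exact: measurable_indic.
  transitivity (\int[Q]_w (\sum_(r \in range (g k))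
      (r * (W w * \1_(g k @^-1` [set r]) (Y w)))%:E))%E.
    apply: eq_integral => w _; rewrite fsumEFin//.
    rewrite [in LHS]fimfunE mulr_fsumr//; congr (_%:E).
    by apply: eq_fsbigr => r _; rewrite mulrCA.
  rewrite ge0_integral_fsum//; first last.
  - by move=> r w _; rewrite lee_fin.
  - by move=> r; apply/measurable_EFinP; exact: measurable_funM.
  apply: eq_fsbigr => r; rewrite inE => -[t _ grt].
  under eq_integral do rewrite EFinM.
  rewrite ge0_integralZl//; first last.
  - by rewrite lee_fin -grt.
  - by move=> w _; rewrite lee_fin mulr_ge0.
  - exact/measurable_EFinP.
  by rewrite WA// muleCA.
have lim1 : (\int[Q]_w (W w * g k (Y w))%:E)%E @[k --> \oo] -->
    (\int[Q]_w (W w * h (Y w))%:E)%E.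
  have lE w : limn (fun k => (W w * g k (Y w))%:E) = (W w * h (Y w))%:E.
    apply/cvg_lim => //.
    have -> : (fun k => (W w * g k (Y w))%:E)
        = (fun k => (W w)%:E * (EFin \o g ^~ (Y w)) k)%E by [].
    by rewrite EFinM; apply: cvgeZl.
  have -> : (\int[Q]_w (W w * h (Y w))%:E =
      \int[Q]_w limn (fun k => (W w * g k (Y w))%:E))%E.
    by apply: eq_integral => w _; rewrite lE.
  apply: cvg_monotone_convergence => //.
  - by move=> k; apply/measurable_EFinP; apply: measurable_funM => //; exact: mgY.
  - by move=> k w _; rewrite lee_fin mulr_ge0.
  - by move=> w _ k l kl; rewrite lee_fin ler_wpM2l// ndg.
have lim2 : (\int[P]_t (g k t)%:E)%E @[k --> \oo] -->
    (\int[P]_t (h t)%:E)%E.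
  have lE t : limn (fun k => (g k t)%:E) = (h t)%:E.
    by apply/cvg_lim => //; exact: gh.
  have -> : (\int[P]_t (h t)%:E = \int[P]_t limn (fun k => (g k t)%:E))%E.
    by apply: eq_integral => w _; rewrite lE.
  apply: cvg_monotone_convergence => //.
  - by move=> k; exact/measurable_EFinP.
  - by move=> k w _; rewrite lee_fin.
  - by move=> w _ k l kl; rewrite lee_fin ndg.
have := @cvgeZl _ _ _ _ _ c%:E isT lim2.
under eq_fun do rewrite -simple.
by move/cvg_lim => <- //; apply/esym/cvg_lim.
Qed.

Lemma prod_indic (R : realType) (Omega : Type) (N : nat)
    (B : nat -> set Omega) (w : Omega) :
  \prod_(i < N) \1_(B i) w = \1_(\bigcap_(i in `I_N) B i) w :> R.
Proof.
have [Bw|nBw] := pselect ((\bigcap_(i in `I_N) B i) w).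
  rewrite indicE mem_set// big1// => i _.
  by rewrite indicE mem_set//; apply: Bw => /=.
rewrite [RHS]indicE memNset//; apply/eqP/prodf_eq0.
move/existsNP: nBw => [i /not_implyP[iN nBi]].
by exists (Ordinal iN) => //; rewrite indicE memNset.
Qed.

Section independence.
Context {R : realType} {d d' : measure_display}.
Context {T : measurableType d} {Omega : measurableType d'}.
Context {P : probability T R} {Q : probability Omega R}.
Context {xi : nat -> Omega -> T}.
Hypothesis iid : iid_seq Q P xi.

(* Replaces indicator factors by general ones, one index at a time. *)
Let integral_prod_upto (N k : nat) (H : nat -> T -> R) (m : nat -> R) :
  (forall i, measurable_fun setT (H i)) -> (forall i t, 0 <= H i t) ->
  (forall i, (\int[P]_t (H i t)%:E = (m i)%:E)%E) ->
  (forall i, (k <= i < N)%N -> exists2 A, measurable A & H i = \1_A) ->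
  (\int[Q]_w (\prod_(i < N) H i (xi i w))%:E = (\prod_(i < N) m i)%:E)%E.
Proof.
case: iid => mxi _ ind.
elim: k H m => [|k IH] H m mH H0 Hm Hk.
  (* Independence is stated for a full sequence of measurable sets, so indices from [N] on receive
     [setT]. *)
  have /choice[A Ak] : forall i, exists A, measurable A /\
      ((i < N)%N -> H i = \1_A).
    move=> i; have [iN|iN] := ltnP i N; last by exists setT.
    by have [A mA HA] := Hk i iN; exists A.
  transitivity (\int[Q]_w
      (\1_(\bigcap_(i in `I_N) (xi i @^-1` A i)) w)%:E)%E.
    apply: eq_integral => w _; rewrite -prod_indic; congr (_%:E).
    by apply: eq_bigr => i _; rewrite (Ak i).2.
  have mB i : measurable (xi i @^-1` A i).
    by rewrite -[X in measurable X]setTI; apply: mxi => //; exact: (Ak i).1.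
  rewrite integral_indic ?setIT//; last exact: bigcap_measurableType.
  transitivity (\prod_(i < N) P (A i))%E.
    by apply: ind => i; exact: (Ak i).1.
  rewrite -prodEFin; apply: eq_bigr => i _.
  by rewrite -Hm (Ak i).2// integral_indic ?setIT//; exact: (Ak i).1.
have [kN|Nk] := ltnP k N; last first.
  by apply: IH => // i /andP[ki /(leq_ltn_trans ki)]; rewrite ltnNge Nk.
pose k' := Ordinal kN.
pose W w := \prod_(i < N | i != k') H i (xi i w).
pose c := \prod_(i < N | i != k') m i.
transitivity (\int[Q]_w (W w * H k (xi k w))%:E)%E.
  by apply: eq_integral => w _; rewrite (bigD1 k')//= mulrC.
rewrite (@integral_mul_comp_factor _ _ _ _ _ P _ _ _ c)//.
- by rewrite Hm -EFinM [in RHS](bigD1 k')//= mulrC.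
- rewrite /W; under eq_fun do rewrite -big_filter.
  apply: measurable_prod => i _.
  by apply: measurableT_comp => //; exact: mxi.
- by move=> w; apply: prodr_ge0.
- apply: prodr_ge0 => i _; rewrite -lee_fin -Hm.
  by apply: integral_ge0 => t _; rewrite lee_fin.
move=> A mA.
(* With an indicator put at index [k], all factors from [k] on are indicators, so the induction
   hypothesis supplies the required factorization. *)
pose H' i := if i == k then \1_A else H i.
pose m' i := if i == k then fine (P A) else m i.
have PA : P A \is a fin_num by exact: fin_num_measure.
have WH' w : W w * \1_A (xi k w) = \prod_(i < N) H' i (xi i w).
  rewrite (bigD1 k')//= mulrC {1}/H' eqxx; congr (_ * _).
  by apply: eq_bigr => i; rewrite -val_eqE/= => /negPf ik; rewrite /H' ik.
have mc : \prod_(i < N) m' i = c * fine (P A).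
  rewrite (bigD1 k')//= mulrC {2}/m' eqxx; congr (_ * _).
  by apply: eq_bigr => i; rewrite -val_eqE/= => /negPf ik; rewrite /m' ik.
transitivity (\int[Q]_w (\prod_(i < N) H' i (xi i w))%:E)%E.
  by apply: eq_integral => w _; rewrite WH'.
rewrite (IH H' m') ?mc ?EFinM ?fineK//.
- by move=> i; rewrite /H'; case: eqP.
- by move=> i t; rewrite /H'; case: eqP.
- move=> i; rewrite /H' /m'; case: eqP => // _.
  by rewrite integral_indic// setIT fineK.
- move=> i /andP[]; rewrite leq_eqVlt /H' => /predU1P[<- _|ki iN].
    by rewrite eqxx; exists A.
  by rewrite gtn_eqF//; apply: Hk; rewrite ki.
Qed.

Lemma integral_prod_iid (N : nat) (h : T -> R) (m : R) :
  measurable_fun setT h -> (forall t, 0 <= h t) ->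
  (\int[P]_t (h t)%:E = m%:E)%E ->
  (\int[Q]_w (\prod_(i < N) h (xi i w))%:E = (m ^+ N)%:E)%E.
Proof.
move=> mh h0 hm.
rewrite -[X in m ^+ X]card_ord -prodr_const.
apply: (integral_prod_upto (k := N) (H := fun=> h) (m := fun=> m)) => // i.
by move=> /andP[Ni]; rewrite ltnNge Ni.
Qed.

End independence.

(** * Elementary bounds on the exponential *)

(** Multiplying [1 - x <= expR (- x)] by [expR x] gives [expR x <= 1 + x * expR x]. On the right,
    [expR x] is bounded by the same inequality again if [0 <= x], and from below by [1 + x] if
    [x < 0]. *)
Lemma expR_le_quadratic (R : realType) (x : R) :
  expR x <= 1 + x + x ^+ 2 * expR `|x|.
Proof.
have le1 : expR x <= 1 + x * expR x.
  have := ler_wpM2r (expR_ge0 x) (expR_ge1Dx (- x)).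
  by rewrite expRN mulVf ?gt_eqF ?expR_gt0//; lra.
have [x0|x0] := leP 0 x.
  rewrite ger0_norm//; apply: (le_trans le1).
  by have := ler_wpM2l x0 le1; lra.
have := ler_wnM2l (ltW x0) (expR_ge1Dx x).
have : 1 <= expR `|x| by rewrite -expR0 ler_expR.
move=> /(ler_wpM2l (sqr_ge0 x)); lra.
Qed.

Lemma sqr_le_expR (R : realType) (x : R) : 0 <= x -> x ^+ 2 <= 4 * expR x.
Proof.
move=> x0; have : 1 + x / 2 <= expR (x / 2) by exact: expR_ge1Dx.
have -> : expR x = expR (x / 2) ^+ 2 by rewrite -expRM_natl; congr expR; lra.
by set e := expR _; nra.
Qed.

Lemma expR_norm_le (R : realType) (x : R) : expR `|x| <= expR x + expR (- x).
Proof.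
have [x0|x0] := leP 0 x; first by rewrite ger0_norm// lerDl expR_ge0.
by rewrite ltr0_norm// lerDr expR_ge0.
Qed.

(** The remainder is [t ^+ 2] times a factor free of [t], integrable once the moment generating
    function is finite at [2 * s] and [- (2 * s)]. One exponential absorbs [x ^+ 2], a second one
    dominates that of [t * x]. *)
Lemma expR_scale_le (R : realType) (s t x : R) : 0 < s -> `|t| <= s ->
  expR (t * x) <= 1 + t * x +
    t ^+ 2 * (4 / s ^+ 2 * (expR (2 * s * x) + expR (- (2 * s) * x))).
Proof.
move=> s0 ts; apply: (le_trans (expR_le_quadratic (t * x))).
rewrite lerD2l exprMn -[leLHS]mulrA ler_wpM2l ?sqr_ge0//.
have sx0 : 0 <= s * `|x| by rewrite mulr_ge0// ltW.
have txsx : `|t * x| <= s * `|x| by rewrite normrM ler_wpM2r.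
have x2 : x ^+ 2 <= 4 / s ^+ 2 * expR (s * `|x|).
  rewrite mulrAC ler_pdivlMr ?exprn_gt0// -exprMn -real_normK ?num_real//.
  rewrite normrM (gtr0_norm s0) mulrC; exact: sqr_le_expR.
have c0 : 0 <= 4 / s ^+ 2 by rewrite divr_ge0// exprn_ge0// ltW.
apply: (@le_trans _ _ (4 / s ^+ 2 * expR (s * `|x|) * expR (s * `|x|))).
  by apply: ler_pM; rewrite ?sqr_ge0 ?expR_ge0// ler_expR.
rewrite -mulrA ler_wpM2l// -expRD.
have -> : s * `|x| + s * `|x| = `|2 * s * x|.
  by rewrite !normrM (gtr0_norm s0) ger0_norm//; ring.
by rewrite mulNr; exact: expR_norm_le.
Qed.

(** * Random variables with exponential moments *)

Section light_tailed.
Context {R : realType} {d : measure_display} {T : measurableType d}.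
Context {P : probability T R}.
Implicit Types g h : T -> R.

(** Cramer's condition, with measurability built in. *)
Definition light_tailed g := measurable_fun setT g /\
  exists2 delta : R, 0 < delta &
    forall t : R, `|t| < delta -> (\int[P]_w (expR (t * g w))%:E < +oo)%E.

Lemma measurable_expRM (t : R) g : measurable_fun setT g ->
  measurable_fun setT (fun w => expR (t * g w)).
Proof.
move=> mg; apply: measurableT_comp => //.
exact: measurable_funM.
Qed.

Lemma light_tailed_cst (a : R) : light_tailed (fun=> a).
Proof.
split; first exact: measurable_cst.
exists 1 => // t _; rewrite integral_cst//.
rewrite lte_mul_pinfty ?lee_fin ?expR_ge0//.
by rewrite -ge0_fin_numE// fin_num_measure.
Qed.

Lemma light_tailedZ (a : R) g :
  light_tailed g -> light_tailed (fun w => a * g w).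
Proof.
move=> [mg [delta delta0 Hg]]; split; first exact: measurable_funM.
(* The [+ 1] avoids a division by zero when [a] is 0. *)
have a0 : 0 < `|a| + 1 by rewrite ltr_wpDl.
exists (delta / (`|a| + 1)); first by rewrite divr_gt0.
move=> t; rewrite ltr_pdivlMr// => td.
under eq_integral do rewrite mulrA.
apply: Hg; apply: le_lt_trans td; rewrite normrM ler_wpM2l// lerDl//.
Qed.

(** By [a * b <= a ^+ 2 + b ^+ 2] for the two exponentials, the value at [t] is controlled by those
    at [2 * t]; hence the halved radius. *)
Lemma light_tailedD g h :
  light_tailed g -> light_tailed h -> light_tailed (fun w => g w + h w).
Proof.
move=> [mg [dg dg0 Hg]] [mh [dh dh0 Hh]]; split; first exact: measurable_funD.
exists (Num.min dg dh / 2); first by rewrite divr_gt0// lt_min dg0.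
move=> t; rewrite ltr_pdivlMr// lt_min => /andP[tg th].
have t2 : `|t| * 2 = `|2 * t| by rewrite normrM mulrC ger0_norm.
rewrite t2 in tg th.
have mE (a : R) (k : T -> R) : measurable_fun setT k ->
    measurable_fun setT (fun w : T => (expR (a * k w))%:E).
  by move=> mk; apply/measurable_EFinP; exact: measurable_expRM.
have le : (\int[P]_w (expR (t * (g w + h w)))%:E <=
    \int[P]_w ((expR (2 * t * g w))%:E + (expR (2 * t * h w))%:E))%E.
  apply: ge0_le_integral => //.
  - by apply: mE; exact: measurable_funD.
  - by apply: emeasurable_funD; exact: mE.
  - move=> w _; rewrite -EFinD lee_fin.
    rewrite mulrDr expRD.
    have -> : expR (2 * t * g w) = expR (t * g w) ^+ 2.
      by rewrite -expRM_natl mulrA.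
    have -> : expR (2 * t * h w) = expR (t * h w) ^+ 2.
      by rewrite -expRM_natl mulrA.
    set a := expR _; set b := expR _.
    have := sqr_ge0 (a - b); have := sqr_ge0 a; have := sqr_ge0 b; lra.
apply: (le_lt_trans le).
rewrite (ge0_integralD _ measurableT)//.
- by apply: lte_add_pinfty; [exact: Hg|exact: Hh].
- exact: mE.
- exact: mE.
Qed.

Lemma integrable_expRM (t : R) g : measurable_fun setT g ->
  (\int[P]_w (expR (t * g w))%:E < +oo)%E ->
  P.-integrable setT (fun w => (expR (t * g w))%:E).
Proof.
move=> mg tg; apply/integrableP; split.
  by apply/measurable_EFinP; exact: measurable_expRM.
by under eq_integral do rewrite gee0_abs ?lee_fin ?expR_ge0//.
Qed.

(** The absolute value of [g] is dominated by [s^-1] times the sum of the exponentials of [s * g]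
    and [- s * g]. *)
Lemma light_tailed_integrable g :
  light_tailed g -> P.-integrable setT (EFin \o g).
Proof.
move=> [mg [delta delta0 Hg]].
pose s := delta / 2; have s0 : 0 < s by rewrite divr_gt0.
have sd : `|s| < delta by rewrite gtr0_norm// /s; lra.
have I1 := integrable_expRM mg (Hg s sd).
have I2 : P.-integrable setT (fun w => (expR (- s * g w))%:E).
  by apply: integrable_expRM => //; apply: Hg; rewrite normrN.
have I := integrableZl measurableT s^-1 (integrableD measurableT I1 I2).
apply: (le_integrable measurableT _ _ I); first exact/measurable_EFinP.
move=> w _ /=; rewrite lee_fin [leRHS]ger0_norm; last first.
  by rewrite mulr_ge0 ?addr_ge0 ?expR_ge0// invr_ge0 ltW.
rewrite mulrC ler_pdivlMr// mulNr.
apply: le_trans (expR_norm_le _); rewrite normrM (gtr0_norm s0) mulrC.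
by apply: le_trans (expR_ge1Dx _); rewrite lerDr.
Qed.

End light_tailed.
Arguments light_tailed {R d T} P g.

(* The mgf is 1 + t E[g] + O(t^2) near 0. *)
Lemma light_tailed_mgf_lt1 (R : realType) (d : measure_display)
    (T : measurableType d) (P : probability T R) (g : T -> R) :
  light_tailed P g -> (\int[P]_w (g w)%:E < 0)%E ->
  exists t m : R, [/\ 0 < t, m < 1 & (\int[P]_w (expR (t * g w))%:E = m%:E)%E].
Proof.
move=> ltg mu0; have Ig := light_tailed_integrable ltg.
have [mg [delta delta0 Hg]] := ltg.
have muf : (\int[P]_w (g w)%:E)%E \is a fin_num by exact: integrable_fin_num.
move: mu0; rewrite -(fineK muf) lte_fin; set mu := fine _ => mu0.
(* Dividing by 3 keeps the exponents [2 * s] and [- (2 * s)] within [delta]. *)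
pose s := delta / 3; have s0 : 0 < s by rewrite divr_gt0.
have sd : `|2 * s| < delta by rewrite gtr0_norm ?mulr_gt0// /s; lra.
have I1 := integrable_expRM mg (Hg _ sd).
have I2 : P.-integrable setT (fun w => (expR (- (2 * s) * g w))%:E).
  by apply: integrable_expRM => //; apply: Hg; rewrite normrN.
have I12 := integrableD measurableT I1 I2.
pose M := fine (\int[P]_w
  ((expR (2 * s * g w))%:E + (expR (- (2 * s) * g w))%:E))%E.
have ME : (\int[P]_w
  ((expR (2 * s * g w))%:E + (expR (- (2 * s) * g w))%:E) = M%:E)%E.
  by rewrite fineK//; exact: integrable_fin_num I12.
have M0 : 0 <= M.
  rewrite -lee_fin -ME; apply: integral_ge0 => w _.
  by rewrite -EFinD lee_fin addr_ge0 ?expR_ge0.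
pose c := 4 / s ^+ 2; have c0 : 0 <= c by rewrite divr_ge0// exprn_ge0// ltW.
(* The linear term [t * mu] must beat the remainder [t ^+ 2 * c * M]: this choice makes
   [t * (c * M)] at most half of [- mu], and the [+ 1] keeps the denominator positive. *)
pose t := Num.min s (- mu / (2 * (c * M + 1))).
have cM1 : 0 < c * M + 1 by rewrite ltr_wpDl// mulr_ge0.
have t0 : 0 < t by rewrite lt_min s0/= divr_gt0 ?mulr_gt0// oppr_gt0.
have ts : t <= s by rewrite ge_min lexx.
have tmu : t * (2 * (c * M + 1)) <= - mu.
  by rewrite -ler_pdivlMr ?mulr_gt0// /t ge_min lexx orbT.
have td : `|t| < delta by rewrite gtr0_norm// (le_lt_trans ts)// /s; lra.
have It := integrable_expRM mg (Hg _ td).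
have Itf := integrable_fin_num measurableT It.
exists t, (fine (\int[P]_w (expR (t * g w))%:E)%E); split; last by rewrite fineK.
  exact: t0.
have I0 : P.-integrable setT (fun=> 1%:E).
  by apply: finite_measure_integrable_cst.
have Itg := integrableZl measurableT t Ig.
have Iq := integrableZl measurableT (t ^+ 2 * c) I12.
have le : (\int[P]_w (expR (t * g w))%:E <=
    \int[P]_w ((1%:E + t%:E * (g w)%:E) + (t ^+ 2 * c)%:E *
      ((expR (2 * s * g w))%:E + (expR (- (2 * s) * g w))%:E)))%E.
  apply: le_integral => //.
    exact: (integrableD measurableT (integrableD measurableT I0 Itg) Iq).
  move=> w _; rewrite -EFinM -!EFinD lee_fin -[t ^+ 2 * c * _]mulrA.
  by apply: expR_scale_le => //; rewrite gtr0_norm.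
rewrite -lte_fin fineK//; apply: (le_lt_trans le).
rewrite (integralD measurableT (integrableD measurableT I0 Itg) Iq).
rewrite (integralD measurableT I0 Itg) (integralZl measurableT Ig).
rewrite (integralZl measurableT I12) ME -(fineK muf) -/mu.
have -> : (\int[P]_w 1%:E = 1%:E)%E.
  by rewrite integral_cst//= probability_setT mule1.
rewrite -!EFinM -!EFinD lte_fin.
have : t * (mu + t * (c * M)) < 0 by rewrite pmulr_rlt0//; nra.
lra.
Qed.

(** * Exponentially small events and Chernoff's bound *)

Section exp_decay.
Context {R : realType} {d : measure_display} {Omega : measurableType d}.
Context {Q : probability Omega R}.
Implicit Types A B : nat -> set Omega.

(** Measurability is included for the union bound and for comparing measures. *)
Definition exp_decay A := exists C beta : R, [/\ 0 < C, 0 < beta &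
  forall N, measurable (A N) /\
    (Q (A N) <= (C * expR (- (N%:R * beta)))%:E)%E].

Lemma exp_decayU A B :
  exp_decay A -> exp_decay B -> exp_decay (fun N => A N `|` B N).
Proof.
move=> [C [b [C0 b0 HA]]] [D [c [D0 c0 HB]]].
exists (C + D), (Num.min b c); split; [exact: addr_gt0|by rewrite lt_min b0|].
move=> N; have [mA QA] := HA N; have [mB QB] := HB N.
split; first exact: measurableU.
apply: le_trans; first exact: measureU2.
rewrite mulrDl EFinD; apply: leeD.
  apply: (le_trans QA); rewrite lee_fin ler_pM2l// ler_expR lerN2.
  by rewrite ler_wpM2l// ge_min lexx.
apply: (le_trans QB); rewrite lee_fin ler_pM2l// ler_expR lerN2.
by rewrite ler_wpM2l// ge_min lexx orbT.
Qed.

Lemma exp_decay0 : exp_decay (fun=> set0).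
Proof.
exists 1, 1; split => // N; split => //.
by rewrite measure0 lee_fin mul1r expR_ge0.
Qed.

Lemma exp_decay_bigcup (I : choiceType) (s : seq I)
    (A : I -> nat -> set Omega) : (forall i, i \in s -> exp_decay (A i)) ->
  exp_decay (fun N => \bigcup_(i in [set` s]) A i N).
Proof.
elim: s => [|i s IH] As.
  rewrite (_ : (fun N => _) = fun=> set0); first exact: exp_decay0.
  by apply/funext => N; rewrite set_nil bigcup_set0.
rewrite (_ : (fun N => _) =
    fun N => A i N `|` \bigcup_(i in [set` s]) A i N); last first.
  apply/funext => N; rewrite -bigcup_setU1; congr bigcup.
  by apply/seteqP; split => j /=; rewrite in_cons => /predU1P.
apply: exp_decayU; first by apply: As; rewrite mem_head.
by apply: IH => j js; apply: As; rewrite in_cons js orbT.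
Qed.

End exp_decay.
Arguments exp_decay {R d Omega} Q A.

(** The indicator of the event is at most the product of the [expR (t * g (xi i w))], whose
    expectation is [m ^+ N]; then [m <= expR (- (1 - m))] gives the rate [1 - m]. *)
Lemma exp_decay_iid_sum (R : realType) (d d' : measure_display)
    (T : measurableType d) (Omega : measurableType d')
    (P : probability T R) (Q : probability Omega R)
    (xi : nat -> Omega -> T) (g : T -> R) :
  iid_seq Q P xi -> light_tailed P g -> (\int[P]_w (g w)%:E < 0)%E ->
  exp_decay Q (fun N => [set w | 0 <= \sum_(i < N) g (xi i w)]).
Proof.
move=> iid ltg mu0; have [t [m [t0 m1 tm]]] := light_tailed_mgf_lt1 ltg mu0.
have mg := ltg.1; have [mxi _ _] := iid.
exists 1, (1 - m); split; rewrite ?subr_gt0// => N.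
have mS : measurable_fun setT (fun w => \sum_(i < N) g (xi i w)).
  by apply: measurable_sum => i; exact: measurableT_comp.
have mA : measurable [set w | 0 <= \sum_(i < N) g (xi i w)].
  rewrite -[X in measurable X]setTI.
  rewrite (_ : [set w | _] = (fun w => \sum_(i < N) g (xi i w)) @^-1` `[0, +oo[).
    exact: mS.
  by apply/seteqP; split => w /=; rewrite in_itv/= andbT.
split=> //; rewrite mul1r -[X in (Q X <= _)%E]setIT -integral_indic//.
have m0 : 0 <= m.
  by rewrite -lee_fin -tm; apply: integral_ge0 => w _; rewrite lee_fin expR_ge0.
have mX := integral_prod_iid iid N (measurable_expRM t mg)
  (fun w => expR_ge0 (t * g w)) tm.
apply: (@le_trans _ _ (m ^+ N)%:E).
  rewrite -mX; apply: ge0_le_integral => //.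
  - exact/measurable_EFinP/measurable_indic.
  - apply/measurable_EFinP; apply: measurable_prod => i _.
    exact: (measurableT_comp (measurable_expRM t mg) (mxi i)).
  move=> w _; rewrite -expR_sum -mulr_sumr lee_fin indicE.
  case: (boolP (w \in _)) => [|_]; last exact: expR_ge0.
  by rewrite inE/= => S0; rewrite -expR0 ler_expR mulr_ge0// ltW.
rewrite lee_fin -mulrN expRM_natl.
by apply: lerXn2r; rewrite ?nnegrE ?expR_ge0//; have := expR_ge1Dx (- (1 - m)); lra.
Qed.

(** * Compact neighbourhoods, segments and convexity *)

(** Compactness gives one radius [r] for which all [r]-balls centred in [K] lie in [D]; [U] consists
    of balls of half that radius, which leaves room for its closure. *)
Lemma compact_nbhd_closure (R : realType) (n : nat) (K D : set 'rV[R]_n) :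
  compact K -> K `<=` interior D ->
  exists U, [/\ open U, K `<=` U, compact (closure U) & closure U `<=` D].
Proof.
move=> cK KD.
have [r r0 rD] : exists2 r : R, 0 < r & forall x, K x -> ball x r `<=` D.
  (* Radii run along the filter of small positive numbers, so compactness turns local radii into a
     uniform one. *)
  have /compact_near_coveringP/(_ _ (0^'+ : set_system R)
      (fun e x => ball x e `<=` D) _) := cK.
  case=> [x /KD|].
    move=> /nbhs_ballP[r /= r0 xrD]; have r20 : 0 < r / 2 by rewrite divr_gt0.
    exists (ball x (r / 2), [set e : R | e < r / 2]) => /=.
      by split; [exact: nbhsx_ballx|exact: nbhs_right_lt].
    move=> [y e] /= [xy er] z yz; apply: xrD.
    rewrite (splitr r); apply: ball_triangle xy _.
    by apply: le_ball yz; exact: ltW.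
  move=> e /= e0 eD; exists (e / 2); first by rewrite divr_gt0.
  apply: eD; rewrite /= ?divr_gt0//.
  by rewrite /ball/= sub0r normrN gtr0_norm ?divr_gt0//; lra.
pose U := \bigcup_(x in K) ball x (r / 2).
have r20 : 0 < r / 2 by rewrite divr_gt0.
have clU y : closure U y -> exists2 x, K x & ball x r y.
  move=> /(_ _ (nbhsx_ballx y _ r20)) [z [[x Kx xz] yz]].
  by exists x => //; rewrite (splitr r); apply: ball_triangle xz _; exact: ball_sym.
exists U; split.
- by apply: bigcup_open => x _; exact: ball_open.
- by move=> x Kx; exists x => //; exact: ballxx.
- apply: bounded_closed_compact; last exact: closed_closure.
  have [M [Mreal MK]] := compact_bounded cK.
  exists (M + 1 + r); split; first exact: num_real.
  move=> B MB y /clU[x Kx]; rewrite -ball_normE/= => xy.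
  have M1 : M < M + 1 by rewrite ltrDl.
  have /= xM := MK _ M1 _ Kx.
  by rewrite -[y](subKr x); have := ler_normB x (x - y); lra.
- by move=> y /clU[x Kx xy]; exact: rD xy.
Qed.

(** Otherwise the parameters landing in [U] and in [closure U] coincide and form a nonempty clopen
    subset of the connected interval from 0 to 1; it then contains 1, which puts [y] in [U]. *)
Lemma segment_meets_boundary (R : realType) (V : normedModType R)
    (U : set V) (x y : V) : open U -> U x -> ~ U y ->
  exists2 t : R, 0 <= t <= 1 &
    closure U (t *: y + (1 - t) *: x) /\ ~ U (t *: y + (1 - t) *: x).
Proof.
move=> oU Ux nUy; apply: contrapT => noz; apply: nUy.
pose phi (t : R) : V := t *: y + (1 - t) *: x.
have cphi : continuous phi.
  move=> t; apply: cvgD; first exact: scalel_continuous.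
  by apply: cvgZr_tmp; apply: cvgB; first exact: cvg_cst.
have /(_ _ _ _)/seteqP[||| _ /(_ 1)] :=
  @segment_connected R 0 1 (`[0, 1] `&` phi @^-1` U).
- exists 0; split; first by rewrite /= in_itv/= lexx ler01.
  by rewrite /= /phi scale0r add0r subr0 scale1r.
- by exists (phi @^-1` U) => //; apply: open_comp.
- exists (phi @^-1` closure U).
    by apply: preimage_closed => //; exact: closed_closure.
  apply/seteqP; split => t [t01 Ut]; (split; first exact: t01).
    exact: subset_closure.
  apply: contrapT => nUt; apply: noz; exists t; last by split.
  by move: t01; rewrite /= in_itv.
rewrite /= in_itv/= lexx ler01 => /(_ isT)[_].
by rewrite /phi scale1r subrr scale0r addr0.
Qed.

(* Convexity bounds the empirical sum on the segment by its value at [y],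
   since the minimizer [x] does at least as well there as [y]. *)
Lemma SAA_sum_le_segment (R : realType) (n : nat) (d : measure_display)
    (T : measurableType d) (f : T -> 'rV[R]_n -> \bar R) (N : nat)
    (s : 'I_N -> T) (x y : 'rV[R]_n) (t : R) :
  (0 < N)%N -> (forall w z, f w z != -oo%E) -> (forall w, econvex (f w)) ->
  (SAA_obj f s x < +oo)%E -> (SAA_obj f s x <= SAA_obj f s y)%E ->
  0 <= t <= 1 ->
  let z := t *: x + (1 - t) *: y in
  (forall w, f w y \is a fin_num) -> (forall w, f w z \is a fin_num) ->
  \sum_(i < N) fine (f (s i) z) <= \sum_(i < N) fine (f (s i) y).
Proof.
move=> N0 fNy fcvx xfin xy t01 z fy fz.
have N0R : 0 < (N%:R : R)^-1 by rewrite invr_gt0 ltr0n.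
(* No summand is [-oo], so a single [+oo] would make the whole objective [+oo]. *)
have fx i : f (s i) x \is a fin_num.
  rewrite fin_numE fNy/=; apply/eqP => fxy; move: xfin; rewrite /SAA_obj.
  have -> : (\sum_(i < N) f (s i) x = +oo)%E.
    by apply/esum_eqyP => //; exists i; rewrite mem_index_enum.
  by rewrite gt0_muley// lte_fin.
have sumE u : (forall i, f (s i) u \is a fin_num) ->
    (\sum_(i < N) f (s i) u = (\sum_(i < N) fine (f (s i) u))%:E)%E.
  by move=> fu; rewrite -sumEFin; apply: eq_bigr => i _; rewrite fineK.
have {}xy : \sum_(i < N) fine (f (s i) x) <= \sum_(i < N) fine (f (s i) y).
  move: xy; rewrite /SAA_obj !sumE//.
  by rewrite -!EFinM lee_fin ler_pM2l.
have zle i : fine (f (s i) z) <= t * fine (f (s i) x) + (1 - t) * fine (f (s i) y).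
  rewrite -lee_fin fineK// EFinD !EFinM !fineK// /z.
  (* [econvex] only speaks of [0 < t < 1]; the endpoints are computed directly. *)
  have [->|t0] := eqVneq t 0.
    by rewrite !mul0e add0e subr0 mul1e scale0r add0r scale1r.
  have [->|t1] := eqVneq t 1.
    by rewrite subrr !mul0e adde0 mul1e scale0r addr0 scale1r.
  by apply: fcvx; rewrite !lt_neqAle eq_sym t0 t1.
apply: (@le_trans _ _
    (\sum_(i < N) (t * fine (f (s i) x) + (1 - t) * fine (f (s i) y)))).
  exact: ler_sum.
rewrite big_split/= -!mulr_sumr.
by move: t01 => /andP[t0 _]; have := ler_wpM2l t0 xy; lra.
Qed.

(** * Escape of the SAA solution from a neighbourhood of the optimal set *)

Theorem theorem3p3 (R : realType) (n : nat) (d d' : measure_display)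
  (T : measurableType d) (Omega : measurableType d')
  (P : probability T R) (Q : probability Omega R)
  (f : T -> 'rV[R]_n -> \bar R) (X : set 'rV[R]_n)
  (xi : nat -> Omega -> T)
  (xstar : forall N : nat, ('I_N -> T) -> 'rV[R]_n) :
  (* the feasible set: nonempty, closed, convex *)
  X !=set0 -> closed X -> convex_set X ->
  (* f_xi : R^n -> R \cup {+oo}, convex, and measurable in xi *)
  (forall t x, f t x != -oo%E) ->
  (forall t, econvex (f t)) ->
  (forall x, measurable_fun setT (fun t => f t x)) ->
  (* F > -oo everywhere, and F < +oo somewhere on X *)
  (forall x, Fexp P f x != -oo%E) ->
  (exists x, X x /\ (Fexp P f x < +oo)%E) ->
  (* the optimal set is nonempty and compact *)
  optimal_set X (Fexp P f) !=set0 -> compact (optimal_set X (Fexp P f)) ->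
  (* xi^1, xi^2, ... i.i.d. with law P *)
  iid_seq Q P xi ->
  (* x*(xi^[N]) is an optimal SAA solution with finite value, for each sample *)
  (forall (N : nat) (s : 'I_N -> T), (0 < N)%N -> is_SAA_solution X f s (xstar N s)) ->
  (* the event in question is measurable *)
  (forall N : nat, (0 < N)%N ->
     measurable [set w | (feas_degree P f (xstar N (fun i : 'I_N => xi i w)) < 1)%E]) ->
  (* conditions (C1)-(C3) on every compact subset of dom F *)
  (forall K : set 'rV[R]_n, compact K -> K `<=` domF P f ->
     (* (C1) *)
     (forall x, K x -> exists2 delta : R, 0 < delta &
        forall t : R, `|t| < delta ->
          (\int[P]_w expeR (t%:E * (f w x - Fexp P f x)) < +oo)%E) /\
     (* (C2) and (C3) *)
     (exists kappa : T -> R,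
        [/\ measurable_fun setT kappa, (forall w, 0 <= kappa w),
            P.-integrable setT (EFin \o kappa),
            (forall w, elipschitz_on K (f w) (kappa w)) &
            exists2 delta : R, 0 < delta &
              forall t : R, `|t| < delta ->
                (\int[P]_w (expR (t * kappa w))%:E < +oo)%E])) ->
  (* X* contained in the interior of dom F *)
  optimal_set X (Fexp P f) `<=` interior (domF P f) ->
  exists C beta : R, [/\ 0 < C, 0 < beta &
    forall N : nat, (0 < N)%N ->
      (Q [set w | (feas_degree P f (xstar N (fun i : 'I_N => xi i w)) < 1)%E]
        <= (C * expR (- (N%:R * beta)))%:E)%E].
Proof.
move=> _ clX cvX fNy fcvx mf FNy _ [x0 Ox0] cO iid xstarP mE HK OD.
pose F := Fexp P f.
have [U [oU OU cK KD]] := compact_nbhd_closure cO OD.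
set K := closure U in cK KD.
have [C1 [kappa [mk k0 Ik klip [dk dk0 Hk]]]] := HK K cK KD.
have ffin w y : K y -> f w y \is a fin_num.
  move=> Ky; have := klip w y y Ky Ky; rewrite subrr normr0 mulr0.
  by case: (f w y) => [r| |].
have Kx0 : K x0 by exact/subset_closure/OU.
have Ffin y : K y -> F y \is a fin_num.
  by move=> /KD Fy; rewrite fin_numE FNy lt_eqF.
have tail_f y : K y -> light_tailed P (fun w => fine (f w y)).
  move=> Ky.
  have [delta delta0 Hd] := C1 y Ky.
  (* (C1) concerns the centred variable; the constant [F y] is added back. *)
  rewrite (_ : (fun w => _) =
      fun w => (fine (f w y) - fine (F y)) + fine (F y)); last first.
    by apply/funext => w; rewrite subrK.
  apply: light_tailedD; last exact: light_tailed_cst.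
  split.
    apply: measurable_funB; last exact: measurable_cst.
    exact: measurableT_comp.
  exists delta => // t /Hd; congr (_ < _)%E; apply: eq_integral => w _.
  by rewrite -/F -(fineK (ffin w y Ky)) -(fineK (Ffin y Ky)).
have tail_kappa : light_tailed P kappa by split => //; exists dk.
have FE y : K y -> (\int[P]_w (fine (f w y))%:E = (fine (F y))%:E)%E.
  move=> Ky; rewrite fineK ?Ffin//; apply: eq_integral => w _.
  by rewrite fineK// ffin.
have kfin : (\int[P]_w (kappa w)%:E)%E \is a fin_num.
  exact: integrable_fin_num.
pose L := fine (\int[P]_w (kappa w)%:E)%E.
have L0 : 0 <= L.
  by apply: fine_ge0; apply: integral_ge0 => w _; rewrite lee_fin.
(* By (C2), this bounds [f w x0 - f w z] from above for [y], [z] in [K] at distance less than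
   [e]. *)
pose g (e : R) (y : 'rV[R]_n) w :=
  fine (f w x0) + (-1 * fine (f w y) + e * kappa w).
(* The feasible part of the boundary of [U]. *)
pose S := K `&` ~` U `&` X.
have decay y : S y -> exists2 e : R, 0 < e &
    exp_decay Q (fun N => [set w | 0 <= \sum_(i < N) g e y (xi i w)]).
  move=> [[Ky nUy] Xy].
  (* A feasible [y] with equal value would be optimal, hence in [U]. *)
  have gap : fine (F x0) < fine (F y).
    rewrite -lte_fin !fineK ?Ffin// lt_neqAle.
    have [_ Fx0] := Ox0; rewrite [F x0]Fx0.
    rewrite (_ : (_ <= _)%E); last by apply: ereal_inf_lbound; exists y.
    rewrite andbT; apply/negP => /eqP Fy; apply/nUy/OU; split => //.
  (* With this [e] the mean of [g e y] is [F x0 - F y + e * L = - e]. *)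
  pose e := (fine (F y) - fine (F x0)) / (L + 1).
  have L1 : 0 < L + 1 by rewrite ltr_wpDl.
  have e0 : 0 < e by rewrite divr_gt0// subr_gt0.
  exists e => //; apply: (exp_decay_iid_sum iid).
    apply: light_tailedD; first exact: tail_f.
    by apply: light_tailedD; apply: light_tailedZ => //; exact: tail_f.
  have I1 := light_tailed_integrable (tail_f x0 Kx0).
  have I2 := light_tailed_integrable (light_tailedZ (-1) (tail_f y Ky)).
  have I3 := light_tailed_integrable (light_tailedZ e tail_kappa).
  have I4 := light_tailed_integrable (tail_f y Ky).
  have J2 : (\int[P]_w (-1 * fine (f w y))%:E = (-1 * fine (F y))%:E)%E.
    under eq_integral do rewrite EFinM.
    by rewrite (integralZl measurableT I4) FE.
  have J3 : (\int[P]_w (e * kappa w)%:E = (e * L)%:E)%E.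
    under eq_integral do rewrite EFinM.
    by rewrite (integralZl measurableT Ik) -(fineK kfin).
  rewrite /g; under eq_integral do rewrite EFinD EFinD.
  rewrite (integralD measurableT I1 (integrableD measurableT I2 I3)).
  rewrite (integralD measurableT I2 I3)/= FE// J2 J3 -!EFinD lte_fin.
  have : e * (L + 1) = fine (F y) - fine (F x0) by rewrite divfK ?gt_eqF.
  by nra.
(* A radius must be chosen for all [y]; outside [S] the value 0 is a placeholder. *)
have /choice[e eP] : forall y, exists r : R, S y -> 0 < r /\
    exp_decay Q (fun N => [set w | 0 <= \sum_(i < N) g r y (xi i w)]).
  move=> y; have [/decay[r r0 dr]|nSy] := pselect (S y); first by exists r.
  by exists 0 => /nSy.
have : compact S.
  apply: (subclosed_compact _ cK) => [|y [[]]//].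
  by apply: closedI => //; apply: closedI; [exact: closed_closure|exact: open_closedC].
(* The finite cover is fixed before [N], which makes [C] and [beta] independent of [N]. *)
rewrite compact_cover => /(_ _ S (fun y => ball y (e y))).
case=> [y _|y Sy|J JS SJ]; first exact: ball_open.
  by exists y => //; apply: ballxx; exact: (eP y Sy).1.
have [C [beta [C0 beta0 bound]]] := @exp_decay_bigcup _ _ _ Q _ (finmap.enum_fset J)
  (fun y N => [set w | 0 <= \sum_(i < N) g (e y) y (xi i w)])
  (fun y yJ => (eP y (set_mem (JS y yJ))).2).
exists C, beta; split => // N N0; have [mB QB] := bound N.
apply: le_trans QB; apply: le_measure; rewrite ?inE//; first exact: mE.
move=> w /= degx; pose s (i : 'I_N) := xi i w; rewrite -/s in degx.
have [Xx [xfin xopt]] := xstarP N s N0; set x := xstar N s in Xx xfin xopt degx.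
(* Inside [U] every [f u x] is finite, so the degree of feasibility would be 1. *)
have nUx : ~ U x.
  move=> Ux; move: degx; rewrite /feas_degree (_ : [set _ | _] = setT).
    by rewrite probability_setT ltxx.
  apply/seteqP; split => // u _ /=.
  by have := ffin u x (subset_closure Ux); rewrite fin_numE ltey => /andP[].
have [t t01 [Kz nUz]] := segment_meets_boundary oU (OU _ Ox0) nUx.
set z := t *: x + _ in Kz nUz.
have Xz : X z.
  have /andP[t0 t1] := t01; apply/set_mem.
  by apply: (cvX x x0 (Itv01 t0 t1)); apply/mem_set; [|exact: Ox0.1].
have [y yJ yz] := SJ z (conj (conj Kz nUz) Xz).
exists y => //=.
have Sy : S y by exact/set_mem/JS.
have Ky : K y by exact: Sy.1.1.
(* The sum of the [f (s i) x0 - f (s i) z] is nonnegative, and each term is at most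
   [g (e y) y (s i)] because [z] lies in the ball around [y]. *)
have := SAA_sum_le_segment N0 fNy fcvx xfin (xopt x0 Ox0.1) t01
  (fun w => ffin w x0 Kx0) (fun w => ffin w z Kz).
rewrite -subr_ge0 -sumrB => /le_trans; apply; apply: ler_sum => i _.
have := klip (s i) y z Ky Kz.
rewrite -(fineK (ffin _ _ Ky)) -(fineK (ffin _ _ Kz)) lee_fin => lip.
move: yz; rewrite -ball_normE/= => /ltW/(ler_wpM2l (k0 (s i))) yz.
by have := le_trans (ler_norm _) (le_trans lip yz); rewrite /g -/(s i); lra.
Qed.
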